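(* Assume there is a homomorphism of (first quadrant, homological) spectral sequences $f^r_{pq}\colon E^r_{pq}\to\bar E^r_{pq}$ such that $f^2_{pq}$ is an isomorphism for all $(p,q)$ with $q\le N$. Then $f^\infty_{pq}\colon E^\infty_{pq}\to\bar E^\infty_{pq}$ is an isomorphism for all $(p,q)$ with $p+q=N$.
   Context: A (homological) spectral sequence is a sequence of bigraded $R$-modules $E^r$ with differentials $d^r\colon E^r\to E^r$ of bidegree $(-r,r-1)$ (i.e. $d^r\colon E^r_{pq}\to E^r_{p-r,q+r-1}$) and isomorphisms $H_*(E^r,d^r)\cong E^{r+1}$. A homomorphism $f\colon E\to\bar E$ is a sequence of bidegree-preserving module homomorphisms $f^r\colon E^r\to\bar E^r$, compatible with the differentials, such that $f^{r+1}$ is the map induced by $f^r$ on homology. All spectral sequences are first quadrant: $E^r_{pq}=0$ if $p<0$ or $q<0$; hence for each $(p,q)$ one has $E^r_{pq}=E^{r+1}_{pq}$ for large $r$, and $E^\infty_{pq}$ and $f^\infty_{pq}$ denote these stable values. $N$ is a nonnegative integer. *)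

(* Defs.v *)
From HB Require Import structures.
From mathcomp Require Import all_boot all_order all_algebra.
From mathcomp Require Import boolp.

Set Implicit Arguments.
Unset Strict Implicit.
Unset Printing Implicit Defensive.

Import Order.TTheory GRing.Theory Num.Theory.
Import Quotient.
Local Open Scope ring_scope.
Local Open Scope quotient_scope.

Section Homology.
Variables (R : pzRingType) (A B C : lmodType R).
Variables (f : {linear A -> B}) (g : {linear B -> C}).

Definition is_cycle : {pred B} := [pred x | g x == 0].

Lemma is_cycle_submod_closed : submod_closed is_cycle.
Proof.
split; first by rewrite inE linear0.
by move=> a x y; rewrite !inE linearP => /eqP -> /eqP ->; rewrite scaler0 addr0.
Qed.

HB.instance Definition _ :=
  GRing.isSubmodClosed.Build R B is_cycle is_cycle_submod_closed.

Record cycles := Cycle { cycle_val : B; cycleP : cycle_val \in is_cycle }.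

HB.instance Definition _ := [isSub for cycle_val].
HB.instance Definition _ := [Choice of cycles by <:].
HB.instance Definition _ := [SubChoice_isSubLmodule of cycles by <:].

(* When [g \o f = 0] these are all the elements of the image of [f]. *)
Definition is_boundary : {pred cycles} :=
  [pred z | `[< exists a, val z = f a >]].

Lemma is_boundaryP (z : cycles) :
  reflect (exists a, val z = f a) (z \in is_boundary).
Proof. exact: asboolP. Qed.

Lemma is_boundary_submod_closed : submod_closed is_boundary.
Proof.
split; first by apply/is_boundaryP; exists 0; rewrite linear0.
move=> a x y /is_boundaryP[u xu] /is_boundaryP[v yv]; apply/is_boundaryP.
by exists (a *: u + v); rewrite linearP -xu -yv.
Qed.

HB.instance Definition _ :=
  GRing.isSubmodClosed.Build R cycles is_boundary is_boundary_submod_closed.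

Definition homology := {quot is_boundary}.

HB.instance Definition _ := GRing.Zmodule.on homology.
HB.instance Definition _ := EqQuotient.on homology.

Definition homology_class (z : cycles) : homology := \pi_homology z.

Lemma homology_classE (x y : cycles) :
  (homology_class x == homology_class y) = (x - y \in is_boundary).
Proof. by rewrite idealrBE. Qed.

Lemma homology_class_is_zmod_morphism : zmod_morphism homology_class.
Proof. exact: pi_is_zmod_morphism. Qed.

HB.instance Definition _ :=
  GRing.isZmodMorphism.Build cycles homology homology_class
    homology_class_is_zmod_morphism.

Lemma homology_class_repr (h : homology) : homology_class (repr h) = h.
Proof. exact: reprK. Qed.

Definition homology_scale (a : R) (h : homology) : homology :=
  homology_class (a *: repr h).

Lemma homology_scaleE a z :
  homology_scale a (homology_class z) = homology_class (a *: z).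
Proof.
apply/eqP; rewrite /homology_scale homology_classE -scalerBr rpredZ //.
by rewrite -homology_classE homology_class_repr.
Qed.

Lemma homology_scaleA a b h :
  homology_scale a (homology_scale b h) = homology_scale (a * b) h.
Proof. by rewrite -[h]homology_class_repr !homology_scaleE scalerA. Qed.

Lemma homology_scale1 : left_id 1 homology_scale.
Proof.
by move=> h; rewrite -[h]homology_class_repr homology_scaleE scale1r.
Qed.

Lemma homology_scaleDr : right_distributive homology_scale +%R.
Proof.
move=> a x y; rewrite -[x]homology_class_repr -[y]homology_class_repr.
by rewrite -raddfD !homology_scaleE scalerDr raddfD.
Qed.

Lemma homology_scaleDl h : {morph homology_scale^~ h : a b / a + b}.
Proof.
by move=> a b; rewrite -[h]homology_class_repr !homology_scaleE scalerDl raddfD.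
Qed.

HB.instance Definition _ := GRing.Zmodule_isLmodule.Build R homology
  homology_scaleA homology_scale1 homology_scaleDr homology_scaleDl.

Lemma homology_class_is_scalable : scalable homology_class.
Proof. by move=> a z; rewrite -homology_scaleE. Qed.

HB.instance Definition _ :=
  GRing.isScalable.Build R cycles homology *:%R homology_class
    homology_class_is_scalable.

End Homology.

Arguments is_boundary {R A B C} f g.

Section HomologyMap.
Variables (R : pzRingType) (A B C A' B' C' : lmodType R).
Variables (f : {linear A -> B}) (g : {linear B -> C}).
Variables (f' : {linear A' -> B'}) (g' : {linear B' -> C'}).
Variables (u : {linear A -> A'}) (v : {linear B -> B'}) (w : {linear C -> C'}).

Lemma cycles_map_subproof (wg : forall y, w (g y) = g' (v y)) (z : cycles g) :
  v (val z) \in is_cycle g'.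
Proof. by rewrite inE -wg (eqP (cycleP z)) linear0. Qed.

Definition cycles_map (wg : forall y, w (g y) = g' (v y)) (z : cycles g) :
    cycles g' :=
  Cycle (cycles_map_subproof wg z).

(* The hypothesis [vf] makes this independent of the representative of the
   class [h]: see [homology_mapE]. *)
Definition homology_map (vf : forall x, v (f x) = f' (u x))
    (wg : forall y, w (g y) = g' (v y)) (h : homology f g) : homology f' g' :=
  homology_class f' (cycles_map wg (repr h)).

Lemma homology_mapE (vf : forall x, v (f x) = f' (u x))
    (wg : forall y, w (g y) = g' (v y)) (z : cycles g) :
  homology_map vf wg (homology_class f z) =
  homology_class f' (cycles_map wg z).
Proof.
apply/eqP; rewrite homology_classE.
have : repr (homology_class f z) - z \in is_boundary f g.
  by rewrite -homology_classE homology_class_repr.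
case/is_boundaryP => a za; apply/is_boundaryP; exists (u a).
by rewrite -vf -za /= linearB.
Qed.

End HomologyMap.

(* A homological spectral sequence of R-modules whose first page is E^s.
   The entries [page r] with r < s are meaningless: nothing is assumed of them.
   The differential of E^r, an endomorphism of a bigraded module, is given by
   all its components E^r_{pq} -> E^r_{p'q'}; being of bidegree (-r, r-1) means
   that the components with (p', q') <> (p - r, q + r - 1) are zero. *)
Record spectral_sequence (R : pzRingType) (s : nat) := SpectralSequence {
  page :> nat -> int -> int -> lmodType R;
  diff : forall (r : nat) (p q p' q' : int),
    {linear page r p q -> page r p' q'};
  diff_bidegree : forall (r : nat) (p q p' q' : int), (s <= r)%N ->
    (p', q') <> (p - r%:Z, q + r%:Z - 1) ->
    forall x, diff r p q p' q' x = 0;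
  diff_diff : forall (r : nat) (p q p' q' p'' q'' : int), (s <= r)%N ->
    forall x, diff r p' q' p'' q'' (diff r p q p' q' x) = 0;
  next_page : forall (r : nat) (p q : int),
    {linear homology (diff r (p + r%:Z) (q - r%:Z + 1) p q)
                     (diff r p q (p - r%:Z) (q + r%:Z - 1))
            -> page r.+1 p q};
  next_page_bij : forall (r : nat) (p q : int), (s <= r)%N ->
    bijective (next_page r p q)
}.

Definition first_quadrant (R : pzRingType) (s : nat)
    (E : spectral_sequence R s) : Prop :=
  forall (r : nat) (p q : int), (s <= r)%N -> (p < 0) || (q < 0) ->
  forall x : E r p q, x = 0.

Record ss_hom (R : pzRingType) (s : nat) (E F : spectral_sequence R s) := SSHom {
  ss_map :> forall (r : nat) (p q : int), {linear E r p q -> F r p q};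
  ss_map_diff : forall (r : nat) (p q p' q' : int), (s <= r)%N ->
    forall x, ss_map r p' q' (diff E r p q p' q' x) =
              diff F r p q p' q' (ss_map r p q x);
  ss_map_next : forall (r : nat) (p q : int) (sr : (s <= r)%N),
    forall h, ss_map r.+1 p q (next_page E r p q h) =
      next_page F r p q
        (homology_map (ss_map_diff p q sr)
                      (ss_map_diff (p - r%:Z) (q + r%:Z - 1) sr) h)
}.

(* In a first quadrant spectral sequence the differentials of E^r into and out
   of position (p, q) vanish as soon as r > q + 1 and r > p; the identifications
   E^r_{pq} = E^{r+1}_{pq} from there on are [stable_page_iso] below. *)
Definition stable_page (s : nat) (p q : int) : nat :=
  maxn s (maxn `|p|.+1 `|q|.+2).

Definition Einfty (R : pzRingType) (s : nat) (E : spectral_sequence R s)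
    (p q : int) : lmodType R :=
  E (stable_page s p q) p q.

Definition ss_map_infty (R : pzRingType) (s : nat) (E F : spectral_sequence R s)
    (f : ss_hom E F) (p q : int) : {linear Einfty E p q -> Einfty F p q} :=
  f (stable_page s p q) p q.

Section StablePage.
Variables (R : pzRingType) (s : nat).

Lemma stable_page_ge (p q : int) (r : nat) : (stable_page s p q <= r)%N ->
  [/\ (s <= r)%N, p - r%:Z < 0 & q - r%:Z + 1 < 0].
Proof.
rewrite !geq_max => /and3P[sr pr qr]; split=> //.
  by rewrite subr_lt0 (le_lt_trans (ler_norm p)) // -abszE ltz_nat.
rewrite -addrA [- _ + _]addrC addrA subr_lt0.
rewrite (@le_lt_trans _ _ (`|q|%:Z + 1)) ?lerD2r ?abszE ?ler_norm //.
by rewrite -abszE -PoszD addn1 ltz_nat.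
Qed.

Lemma stable_page_iso (E : spectral_sequence R s) (p q : int) (r : nat) :
  first_quadrant E -> (stable_page s p q <= r)%N ->
  exists phi : {linear E r p q -> E r.+1 p q}, bijective phi /\
    forall z : cycles (diff E r p q (p - r%:Z) (q + r%:Z - 1)),
      phi (val z) = next_page E r p q (homology_class _ z).
Proof.
move=> E1 /stable_page_ge[sr pr qr].
set g := diff E r p q _ _.
have cyc x : x \in is_cycle g.
  by rewrite inE; apply/eqP; apply: E1 => //; rewrite pr.
pose Z x := Cycle (cyc x).
have ZE (z : cycles g) : Z (val z) = z by apply: val_inj.
have Zlin : linear (fun x => next_page E r p q (homology_class _ (Z x))).
  move=> a x y; rewrite -!linearP; congr (next_page _ _ _ _ (homology_class _ _)).
  exact: val_inj.
pose L := GRing.isLinear.Build _ _ _ _ _ Zlin.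
pose phi : {linear E r p q -> E r.+1 p q} := HB.pack
  (fun x => next_page E r p q (homology_class _ (Z x))) L.
exists phi; split=> [|z]; last by rewrite /= ZE.
have [k nk kn] := next_page_bij E p q sr.
exists (fun y => cycle_val (repr (k y))) => [x|y] /=.
  rewrite nk; set h := homology_class _ _.
  have : repr h - Z x \in is_boundary
      (diff E r (p + r%:Z) (q - r%:Z + 1) p q) g.
    by rewrite -homology_classE homology_class_repr.
  case/is_boundaryP => a; rewrite (E1 _ _ _ sr _ a) ?qr ?orbT // linear0 /=.
  by move/eqP; rewrite subr_eq0 => /eqP.
by rewrite ZE homology_class_repr kn.
Qed.

Lemma ss_map_next_class (E F : spectral_sequence R s) (f : ss_hom E F)
    (p q : int) (r : nat) (sr : (s <= r)%N)
    (z : cycles (diff E r p q (p - r%:Z) (q + r%:Z - 1))) :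
  f r.+1 p q (next_page E r p q (homology_class _ z)) =
  next_page F r p q (homology_class _
    (cycles_map (ss_map_diff f (p - r%:Z) (q + r%:Z - 1) sr) z)).
Proof. by rewrite (ss_map_next f sr) homology_mapE. Qed.

End StablePage.

(* Main.v *)
Require Import Defs.
From mathcomp Require Import all_boot all_order all_algebra.
From mathcomp Require Import zify.
From mathcomp Require boolp.

Set Implicit Arguments.
Unset Strict Implicit.

Import Order.TTheory GRing.Theory.
Local Open Scope ring_scope.

(** By induction on r >= 2, f^r is injective in total degrees p + q <= N and
    surjective at all (p, q) with p + q <= N + 1 and q <= N. Injectivity of
    f^(r+1) uses surjectivity of f^r at the source of the incoming differential,
    which lies one total degree higher and satisfies q - r + 1 <= N; surjectivity
    of f^(r+1) uses injectivity of f^r at the target of the outgoing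
    differential, which lies one total degree lower. *)

Lemma inj_surj_bij (A B : Type) (f : A -> B) :
  injective f -> (forall y, exists x, f x = y) -> bijective f.
Proof.
move=> f_inj /boolp.choice[g gK]; exists g => // x.
by apply: f_inj; rewrite gK.
Qed.

Lemma bij_surj (A B : Type) (f : A -> B) :
  bijective f -> forall y, exists x, f x = y.
Proof. by case=> g _ gK y; exists (g y). Qed.

Section HomologyMapInjSurj.
Variables (R : pzRingType) (A B C A' B' C' : lmodType R).
Variables (f : {linear A -> B}) (g : {linear B -> C}).
Variables (f' : {linear A' -> B'}) (g' : {linear B' -> C'}).
Variables (u : {linear A -> A'}) (v : {linear B -> B'}) (w : {linear C -> C'}).
Variables (vf : forall x, v (f x) = f' (u x)).
Variables (wg : forall y, w (g y) = g' (v y)).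

(** If the images of two cycles differ by [f' a'], a lift [a] of [a'] along [u] shows, by
    injectivity of [v], that the cycles themselves differ by [f a]. *)
Lemma homology_map_inj : (forall y, exists x, u x = y) -> injective v ->
  injective (homology_map vf wg).
Proof.
move=> u_surj v_inj h k.
rewrite -[h]homology_class_repr -[k]homology_class_repr !homology_mapE.
move=> /eqP; rewrite homology_classE => /is_boundaryP[a'].
have [a <-] := u_surj a'; rewrite /= -vf -linearB => /v_inj E.
by apply/eqP; rewrite homology_classE; apply/is_boundaryP; exists a.
Qed.

(** A [v]-preimage of a cycle is again a cycle, because [w] is injective and sends its image under
    [g] to 0. *)
Lemma homology_map_surj : (forall y, exists x, v x = y) -> injective w ->
  forall k, exists h, homology_map vf wg h = k.
Proof.
move=> v_surj w_inj k; rewrite -[k]homology_class_repr.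
have [b vb] := v_surj (val (repr k)).
have gb : b \in is_cycle g.
  rewrite inE; apply/eqP/w_inj.
  by rewrite wg vb linear0; apply/eqP; apply: (cycleP (repr k)).
exists (homology_class f (Cycle gb)); rewrite homology_mapE.
by congr homology_class; apply: val_inj.
Qed.

End HomologyMapInjSurj.

Section NextPage.
Variables (R : pzRingType) (s : nat) (E F : spectral_sequence R s).
Variables (f : ss_hom E F) (r : nat) (sr : (s <= r)%N) (p q : int).

(** The bijections [next_page] identify [f r.+1] with the map induced by [f r] on homology. *)
Lemma ss_map_next_inj :
  (forall y, exists x, f r (p + r%:Z) (q - r%:Z + 1) x = y) ->
  injective (f r p q) -> injective (f r.+1 p q).
Proof.
move=> u_surj v_inj x y.
have [h <-] := bij_surj (next_page_bij E p q sr) x.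
have [k <-] := bij_surj (next_page_bij E p q sr) y.
rewrite !(ss_map_next f sr) => /(bij_inj (next_page_bij F p q sr)) hk.
by congr (next_page E r p q _); apply: homology_map_inj hk.
Qed.

Lemma ss_map_next_surj :
  (forall y, exists x, f r p q x = y) ->
  injective (f r (p - r%:Z) (q + r%:Z - 1)) ->
  forall y, exists x, f r.+1 p q x = y.
Proof.
move=> v_surj w_inj y.
have [k <-] := bij_surj (next_page_bij F p q sr) y.
have [h <-] := homology_map_surj
  (ss_map_diff f p q sr) (ss_map_diff f (p - r%:Z) (q + r%:Z - 1) sr)
  v_surj w_inj k.
by exists (next_page E r p q h); rewrite (ss_map_next f sr).
Qed.

End NextPage.

(** Injectivity is claimed in all rows because outgoing differentials may climb above row [N];
    incoming ones start in lower rows, so surjectivity can keep the bound [q <= N]. *)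
Lemma ss_map_inj_surj (R : pzRingType) (s : nat) (s_le2 : (s <= 2)%N) (N : nat)
    (E F : spectral_sequence R s) (E_quadrant : first_quadrant E)
    (f : ss_hom E F)
    (f2_iso : forall p q : int, q <= N%:Z -> bijective (f 2%N p q))
    (r : nat) (r_ge2 : (2 <= r)%N) :
  (forall p q : int, p + q <= N%:Z -> injective (f r p q)) /\
  (forall p q : int, p + q <= N%:Z + 1 -> q <= N%:Z ->
    forall y, exists x, f r p q x = y).
Proof.
(* This settles the positions with [p + q <= N] but [q > N], where [p < 0]. *)
have E0_inj t p q : (2 <= t)%N -> p < 0 -> injective (f t p q).
  move=> t2 p0 x y _; have st := leq_trans s_le2 t2.
  by rewrite (E_quadrant t p q st _ x) ?p0 // (E_quadrant t p q st _ y) ?p0.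
elim: r r_ge2 => // r IHr; rewrite leq_eqVlt => /predU1P[<-|r2].
  split=> [p q pqN|p q _ qN]; last exact/bij_surj/f2_iso.
  have [/E0_inj|p0] := ltP p 0; first exact.
  by apply/bij_inj/f2_iso; lia.
have [inj_r surj_r] := IHr r2; have sr := leq_trans s_le2 r2.
split=> [p q pqN|p q pqN qN].
  have [/E0_inj|p0] := ltP p 0; first by apply; lia.
  by apply: (ss_map_next_inj sr); [apply: surj_r; lia | exact: inj_r].
by apply: (ss_map_next_surj sr); [exact: surj_r | apply: inj_r; lia].
Qed.

Theorem lemmaA8 (R : pzRingType) (s : nat) (s_le2 : (s <= 2)%N) (N : nat)
    (E F : spectral_sequence R s)
    (E_quadrant : first_quadrant E) (F_quadrant : first_quadrant F)
    (f : ss_hom E F)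
    (f2_iso : forall p q : int, q <= N%:Z -> bijective (f 2%N p q)) :
  forall p q : int, p + q = N%:Z -> bijective (ss_map_infty f p q).
Proof.
move=> p q pqN.
have st2 : (2 <= stable_page s p q)%N by rewrite /stable_page !leq_max !orbT.
have [inj_f surj_f] := ss_map_inj_surj s_le2 E_quadrant f2_iso st2.
have [q_le|q_gt] := leP q N%:Z.
  by apply: inj_surj_bij; [apply: inj_f; lia | apply: surj_f; lia].
have s_le := leq_trans s_le2 st2.
apply: inj_surj_bij => [|y]; first by apply: inj_f; lia.
(* Here [q > N] forces [p < 0], so the target is zero. *)
exists 0; rewrite linear0; apply/esym/(F_quadrant _ p q s_le).
by apply/orP; left; lia.
Qed.
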